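(* For $s\in(0,s_{\max}]$ and $M>0$, define $$\mathcal D:=C^s(M)\setminus\bigcup_{\varepsilon\in(0,1),\,\rho\in\mathbb N}C^s_0(M,\varepsilon,\rho).$$ Further define a probability measure $\pi$ on $f\in C^s(M)$, with $f$ having independently distributed wavelet coefficients $$\alpha_k\sim M2^{-j_0(s+1/2)}\,U([-1,1]),\qquad \beta_{j,k}\sim M2^{-j(s+1/2)}\,U([-1,1]),$$ where $U([-1,1])$ is the uniform distribution on $[-1,1]$. Then: (i) $\mathcal D$ is nowhere dense in $C^s(M)$ with the topology induced by the norm $\|\cdot\|_{C^s}$; and (ii) $\pi(\mathcal D)=0$.
   Context: Wavelet basis: $\varphi,\psi$ are the scaling function and wavelet of an orthonormal multiresolution analysis of $L^2(\mathbb R)$ such that, for some $K,N\in\mathbb N$: $\varphi,\psi$ are supported in $[1-K,K]$; $\int x^i\psi(x)\,dx=0$ for $i=0,\dots,N-1$; $\varphi$ is twice continuously differentiable. From these, the Cohen–Daubechies–Vial boundary-corrected construction gives an orthonormal basis of $L^2([0,1])$ consisting of $\varphi_{j_0,k}$, $0\le k<2^{j_0}$, and $\psi_{j,k}$, $j\ge j_0$, $0\le k<2^j$, for a suitable fixed coarsest level $j_0>0$. For $k\in[N,2^j-N)$ the functions are $\varphi_{j_0,k}(x)=2^{j_0/2}\varphi(2^{j_0}x-k)$ and $\psi_{j,k}(x)=2^{j/2}\psi(2^jx-k)$; for the other $k$ they are the boundary functions of that construction. For $f=\sum_k\alpha_k\varphi_{j_0,k}+\sum_{j\ge j_0}\sum_k\beta_{j,k}\psi_{j,k}\in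 L^2([0,1])$ and $s\in(0,N)$ put $\|f\|_{C^s}:=\max\big(\sup_k|\alpha_k|,\ \sup_{j,k}2^{j(s+1/2)}|\beta_{j,k}|\big)$ and $C^s(M):=\{f\in L^2([0,1]):\|f\|_{C^s}\le M\}$. Set $f_{i,j}:=\sum_{l=i}^j\sum_k\beta_{l,k}\psi_{l,k}$ for $i>j_0$, and $f_{j_0,j}:=\sum_k\alpha_k\varphi_{j_0,k}+\sum_{l=j_0}^j\sum_k\beta_{l,k}\psi_{l,k}$. Self-similar functions: fix $s_{\max}\in(0,N)$. For $s\in(0,s_{\max})$, $M>0$, $\varepsilon\in(0,1)$, $\rho\in\mathbb N$, $C^s_0(M,\varepsilon,\rho)$ is the set of $f\in C^s(M)$ with $\|f_{j,\rho j}\|_{C^s}\ge\varepsilon M$ for all $j\ge j_0$. For $s=s_{\max}$, $C^{s_{\max}}_0(M,\varepsilon,\rho)$ is the set of $f\in C^{s_{\max}}(M)$ for which this inequality holds for $j=j_0$ only. *)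

(* Defs.v *)
From HB Require Import structures.
From mathcomp Require Import all_boot all_order all_algebra finmap.
From mathcomp Require Import all_classical all_reals all_analysis.
From mathcomp Require Import measurable_realfun.

Set Implicit Arguments.
Unset Strict Implicit.
Unset Printing Implicit Defensive.

Import Order.TTheory GRing.Theory Num.Theory.
Import numFieldNormedType.Exports.

Local Open Scope classical_set_scope.
Local Open Scope ring_scope.

Section HilbertBases.
Context {R : realType} (mu : {measure set (measurableTypeR R) -> \bar R}).

Definition inner (f g : R -> R) : R := \int[mu]_x (f x * g x).

Definition orthonormal_family (I : eqType) (e : I -> R -> R) : Prop :=
  (forall i, e i \in Lfun mu 2%:E) /\
  (forall i j, inner (e i) (e j) = (i == j)%:R).

(* The closed linear span of e in L^2(mu), as a set of square-integrable
   functions; it is stable under mu-a.e. equality. *)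
Definition closed_span (I : eqType) (e : I -> R -> R) : set (R -> R) :=
  [set f | f \in Lfun mu 2%:E /\
    forall eps : R, 0 < eps -> exists (F : seq I) (c : I -> R),
      (Lnorm mu 2%:E (fun x => (f x - \sum_(i <- F) c i * e i x)%:E)
         < eps%:E)%E].

Definition orthonormal_basis (V : set (R -> R)) (I : eqType)
    (e : I -> R -> R) : Prop :=
  orthonormal_family e /\ V = closed_span e.

End HilbertBases.

Section Multiresolution.
Context {R : realType}.
Notation leb := (@lebesgue_measure R).

(* phi and psi are the scaling function and the wavelet of the orthonormal
   multiresolution analysis (V_j) of L^2(R). *)
Definition multiresolution (V : int -> set (R -> R)) (phi psi : R -> R) : Prop :=
  [/\ (forall j f, V j f -> f \in Lfun leb 2%:E),
      (forall j, V j `<=` V (j + 1)),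
      (forall f, (forall j, V j f) -> {ae leb, forall x, f x = 0}) &
      (forall f, f \in Lfun leb 2%:E -> forall eps : R, 0 < eps ->
         exists (j : int) (g : R -> R), V j g /\
           (Lnorm leb 2%:E (fun x => (f x - g x)%:E) < eps%:E)%E)] /\
  [/\ (forall j f, V j f <-> V (j + 1) (fun x => f (2 * x))),
      orthonormal_basis leb (V 0) (fun (k : int) x => phi (x - k%:~R)) &
      orthonormal_basis leb
        [set f | V 1 f /\ forall g, V 0 g -> inner leb f g = 0]
        (fun (k : int) x => psi (x - k%:~R))].

Definition twice_continuously_differentiable (f : R -> R) : Prop :=
  [/\ (forall x, derivable f x 1), (forall x, derivable (derive1 f) x 1) &
      continuous (derive1n 2 f)].

End Multiresolution.

(* The boundary functions of Cohen, Daubechies and Vial at the left end of the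
   half-line [0, +oo[. Near 0, only the translates phi(. - m) with m >= N are
   kept; N functions are added so that all polynomials of degree < N are still
   reproduced. *)
Section Edge.
Context {R : realType}.
Variables (K N : nat) (phi : R -> R).
Notation leb := (@lebesgue_measure R).

Definition half_inner (f g : R -> R) : R := \int[leb]_(x in `[0, +oo[) (f x * g x).

(* Restriction to [0, +oo[ of \sum_n 'C(n, k) phi(. - (N - 1 - n)); as phi
   lives on [1 - K, K], the terms with n > N + K - 2 vanish on [0, +oo[. *)
Definition edge_raw (k : nat) (x : R) : R :=
  if 0 <= x then
    \sum_(k <= n < N + K - 1) 'C(n, k)%:R * phi (x + n%:R - N%:R + 1)
  else 0.

Definition half_orthonormal (e : nat -> R -> R) : Prop :=
  forall k l, (k < N)%N -> (l < N)%N -> half_inner (e k) (e l) = (k == l)%:R.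

(* Gram-Schmidt applied to edge_raw (N - 1), ..., edge_raw 0 in this order,
   i.e. by increasing support; e k is obtained at step k. *)
Definition edge_scaling (e : nat -> R -> R) : Prop :=
  half_orthonormal e /\
  forall k, (k < N)%N -> exists c : nat -> R,
    forall x, e k x = \sum_(N.-1 - k <= i < N) c i * edge_raw i x.

(* The component of the l-th boundary scaling function of the next finer level
   that is orthogonal to the boundary scaling functions e; it is automatically
   orthogonal to the interior functions phi(. - m) and psi(. - m), m >= N. *)
Definition edge_wavelet_raw (e : nat -> R -> R) (l : nat) (x : R) : R :=
  let fine_l y := Num.sqrt 2 * e l (2 * y) in
  fine_l x - \sum_(0 <= m < N) half_inner fine_l (e m) * e m x.

(* The construction takes any orthonormal basis of the span of these N linearly
   independent functions. *)
Definition edge_wavelet (e w : nat -> R -> R) : Prop :=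
  half_orthonormal w /\
  forall k, (k < N)%N -> exists c : nat -> R,
    forall x, w k x = \sum_(0 <= l < N) c l * edge_wavelet_raw e l x.

End Edge.

(* Lebesgue measure on [0, 1], as a measure on R. *)
Definition leb01 (R : realType) : set (measurableTypeR R) -> \bar R :=
  mrestr (@lebesgue_measure R) (measurable_itv `[0 : R, 1]).
Arguments leb01 : clear implicits.
HB.instance Definition _ (R : realType) := Measure.on (leb01 R).

(* Level-j basis functions on [0, 1], 0 <= k < 2^j, from the interior function f
   and the families el, er of boundary functions. The right boundary is treated
   by the reflection x |-> 1 - x. *)
Definition interval_fun (R : realType) (N : nat) (f : R -> R)
    (el er : nat -> R -> R) (j k : nat) (x : R) : R :=
  2 `^ (j%:R / 2) *
  (if (k < N)%N then el k (2 ^+ j * x)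
   else if (k < 2 ^ j - N)%N then f (2 ^+ j * x - k%:R)
   else er (2 ^ j - 1 - k)%N (2 ^+ j * (1 - x))).

(* Indices of the basis: inl k stands for phi_{j0,k} and inr (i, k) for
   psi_{j0+i,k}. *)
Definition wavelet_index (j0 : nat) : choiceType :=
  ('I_(2 ^ j0) + {i : nat & 'I_(2 ^ (j0 + i))})%type.

Definition index_level (j0 : nat) (i : wavelet_index j0) : nat :=
  match i with inl _ => j0 | inr p => (j0 + tag p)%N end.

Definition interval_basis (R : realType) (j0 : nat)
    (phi_ psi_ : nat -> nat -> R -> R) (i : wavelet_index j0) : R -> R :=
  match i with
  | inl k => phi_ j0 k
  | inr p => psi_ (j0 + tag p)%N (tagged p)
  end.

Record cdv_basis (R : realType) := CDVBasis {
  wK : nat;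
  wN : nat;
  wj0 : nat;
  wphi : R -> R;
  wpsi : R -> R;
  wV : int -> set (R -> R);
  (* boundary functions; the right ones are those of the reflected scaling
     function phi(1 - .), which is again supported in [1 - K, K] *)
  phil : nat -> R -> R;
  phir : nat -> R -> R;
  psil : nat -> R -> R;
  psir : nat -> R -> R;
  wmra : multiresolution wV wphi wpsi;
  wphi_supp : forall x, ~~ (1 - wK%:R <= x <= wK%:R) -> wphi x = 0;
  wpsi_supp : forall x, ~~ (1 - wK%:R <= x <= wK%:R) -> wpsi x = 0;
  wpsi_moments : forall i, (i < wN)%N ->
    \int[@lebesgue_measure R]_x (x ^+ i * wpsi x) = 0;
  wphi_C2 : twice_continuously_differentiable wphi;
  phil_edge : edge_scaling wK wN wphi phil;
  phir_edge : edge_scaling wK wN (fun x => wphi (1 - x)) phir;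
  psil_edge : edge_wavelet wN phil psil;
  psir_edge : edge_wavelet wN phir psir;
  wj0_gt0 : (0 < wj0)%N;
  (* the left and right boundary index ranges do not overlap *)
  wj0_large : (2 * wN <= 2 ^ wj0)%N;
  wbasis : orthonormal_basis (leb01 R) [set f | f \in Lfun (leb01 R) 2%:E]
    (interval_basis (j0 := wj0) (interval_fun wN wphi phil phir)
                                (interval_fun wN wpsi psil psir))
}.

Section HoelderClasses.
Context {R : realType} (b : cdv_basis R).

Definition phijk : nat -> nat -> R -> R :=
  interval_fun (wN b) (wphi b) (phil b) (phir b).
Definition psijk : nat -> nat -> R -> R :=
  interval_fun (wN b) (wpsi b) (psil b) (psir b).

Definition alpha (f : R -> R) (k : nat) : R :=
  inner (leb01 R) f (phijk (wj0 b) k).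
Definition beta (f : R -> R) (j k : nat) : R :=
  inner (leb01 R) f (psijk j k).
Definition coef (f : R -> R) (i : wavelet_index (wj0 b)) : R :=
  inner (leb01 R) f (interval_basis phijk psijk i).

(* Depends only on the class of f modulo a.e. equality on [0, 1]. *)
Definition Cs_norm (s : R) (f : R -> R) : \bar R :=
  maxe
    (ereal_sup [set `|alpha f k|%:E | k in [set k | (k < 2 ^ wj0 b)%N]])
    (ereal_sup [set (2 `^ (jk.1%:R * (s + 1 / 2)) * `|beta f jk.1 jk.2|)%:E
      | jk in [set jk : nat * nat | (wj0 b <= jk.1)%N /\ (jk.2 < 2 ^ jk.1)%N]]).

(* L^2([0, 1]), modulo a.e. equality. *)
Notation L2 := (LspaceType2 (leb01 R)).

Definition Cs (s M : R) : set L2 :=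
  [set f | (Cs_norm s f <= M%:E)%E].

(* f_{i,j} *)
Definition block (f : R -> R) (i j : nat) (x : R) : R :=
  (if i == wj0 b then \sum_(0 <= k < 2 ^ wj0 b) alpha f k * phijk (wj0 b) k x
   else 0) +
  \sum_(i <= l < j.+1) \sum_(0 <= k < 2 ^ l) beta f l k * psijk l k x.

Definition Cs0 (smax s M eps : R) (rho : nat) : set L2 :=
  [set f | Cs s M f /\
    let large j := ((eps * M)%:E <= Cs_norm s (block f j (rho * j)))%E in
    if s < smax then forall j, (wj0 b <= j)%N -> large j
    else large (wj0 b)].

Definition not_self_similar (smax s M : R) : set L2 :=
  Cs s M `\`
  \bigcup_(eps in `]0, 1[) \bigcup_(rho in [set rho | (0 < rho)%N])
    Cs0 smax s M eps rho.

(* Measurable types are pointed: C^s(M) is pointed by the class of 0. *)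
Let zero_mfun : {mfun measurableTypeR R >-> measurableTypeR R} := cst 0.
Let zero_class : {mfun_(leb01 R), measurableTypeR R >-> measurableTypeR R} :=
  (\pi_(_) zero_mfun)%qT.

Let zero_class_ae : ae_eq (leb01 R) setT (zero_class : R -> R) (cst 0).
Proof.
have /eqP := reprK zero_class; rewrite eqmodE => /asboolP.
by [].
Qed.

Let zero_class_meas : measurable_fun setT (zero_class : measurableTypeR R -> R).
Proof. exact: (measurable_funPT (repr zero_class)). Qed.

Let zero_class_norm : finite_norm (leb01 R) 2%:E (zero_class : R -> R).
Proof.
rewrite /finite_norm unlock /=.
rewrite (ae_eq_integral (cst 0%E)) //.
- rewrite integral0 poweR0r ?invr_neq0 ?pnatr_eq0 //; exact: ltry.
- apply/measurable_EFinP;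
  apply: (@measurableT_comp _ _ _ _ _ _ (@powR R ^~ 2)) => //.
  apply: (@measurableT_comp _ _ _ _ _ _ (@Num.norm R R)) => //.
- have /(ae_eq_comp (fun y : R => (`|y| `^ 2)%:E)) := zero_class_ae.
  by rewrite (_ : _ \o cst 0 = cst 0%E) // funeqE => x /=;
    rewrite normr0 powR0 ?pnatr_eq0.
Qed.

HB.instance Definition _ := isFinLebesgue.Build _ _ _ (leb01 R) 2%:E (lee1n 2)
  zero_class zero_class_norm.
Let zero_L2 : L2 := zero_class.

Let inner0 (g : R -> R) : g \in Lfun (leb01 R) 2%:E ->
  inner (leb01 R) (zero_L2 : R -> R) g = 0.
Proof.
move=> /andP[/[!inE] mg _].
rewrite /inner /Rintegral (ae_eq_integral (cst 0%E)) ?integral0 //.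
- apply/measurable_EFinP; apply: measurable_funM => //; exact zero_class_meas.
- have := ae_eq_comp2 (fun (x : measurableTypeR R) (y : R) => (y * g x)%:E) zero_class_ae.
  by rewrite (_ : (fun x => (cst 0 x * g x)%:E) = cst 0%E) // funeqE => x /=;
    rewrite mul0r.
Qed.

Let basis_Lfun (i : wavelet_index (wj0 b)) : interval_basis phijk psijk i \in Lfun (leb01 R) 2%:E.
Proof. by case: (wbasis b) => -[+ _ _]; exact. Qed.

Let zero_Cs (s M : R) : 0 < M -> Cs s M zero_L2.
Proof.
move=> M0; rewrite /Cs /= /Cs_norm ge_max; apply/andP; split.
  apply: ge_ereal_sup => _ [k /= kj <-].
  rewrite /alpha inner0 ?normr0 ?lee_fin ?ltW //.
  exact: (basis_Lfun (inl (Ordinal kj))).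
apply: ge_ereal_sup => _ [[j k] /= [jj kj] <-].
rewrite /beta inner0 ?normr0 ?mulr0 ?lee_fin ?ltW //.
rewrite -(subnKC jj) in kj *.
exact: (basis_Lfun (inr (Tagged _ (Ordinal kj)))).
Qed.

(* C^s(M), with M > 0, as a type, carrying the topology of the metric induced
   by the norm. *)
Definition Cs_type (s M : R) (M0 : 0 < M) : Type := set_type (Cs s M).

Section Topology.
Variables (s M : R) (M0 : 0 < M).
Notation T := (Cs_type s M0).

Definition Cs_val (f : T) : L2 := val f.

HB.instance Definition _ := gen_eqMixin T.
HB.instance Definition _ := gen_choiceMixin T.
HB.instance Definition _ := isPointed.Build T
  (exist _ zero_L2 (mem_set (zero_Cs s M0))).

Definition Cs_ball (f : T) (r : R) : set T :=
  [set g | (Cs_norm s (fun x => Cs_val f x - Cs_val g x)%R < r%:E)%E].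

Definition Cs_open (U : set T) : Prop :=
  forall f, U f -> exists2 r : R, 0 < r & Cs_ball f r `<=` U.

Let Cs_openT : Cs_open setT.
Proof. by move=> f _; exists 1. Qed.

Let Cs_openI : setI_closed Cs_open.
Proof.
move=> U V oU oV f [/oU[r r0 rU] /oV[t t0 tV]].
exists (Num.min r t); first by rewrite lt_min r0.
by move=> g /=; rewrite /Cs_ball /= EFin_min lt_min => /andP[gr gt]; split;
  [exact: rU | exact: tV].
Qed.

Let Cs_open_bigU (I : Type) (F : I -> set T) :
  (forall i, Cs_open (F i)) -> Cs_open (\bigcup_i F i).
Proof.
move=> oF f [i _ /oF[r r0 rF]]; exists r => // g /rF Fg.
by exists i.
Qed.

HB.instance Definition _ :=
  isOpenTopological.Build T Cs_openT Cs_openI Cs_open_bigU.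

(* The sigma-algebra on C^s(M) generated by the wavelet coefficients. *)
Definition coef_cylinders : set (set T) :=
  [set A | exists (i : wavelet_index (wj0 b)) (B : set (measurableTypeR R)),
     measurable B /\ A = [set f | B (coef (Cs_val f) i)]].

End Topology.

End HoelderClasses.

Arguments not_self_similar {R} b smax s M.
Arguments coef_cylinders {R} b s {M} M0.

Definition nowhere_dense (T : topologicalType) (A : set T) : Prop :=
  interior (closure A) = set0.

Definition mutually_independent d (T : measurableType d) (R : realType)
    (P : probability T R) (I : choiceType) (X : I -> T -> R) : Prop :=
  forall (F : {fset I}) (B : I -> set (measurableTypeR R)),
    (forall i, measurable (B i)) ->
    P (\bigcap_(i in [set` F]) X i @^-1` B i) =
    (\prod_(i <- enum_fset F) P (X i @^-1` B i))%E.

(* X is distributed as c U([-1, 1]). *)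
Definition scaled_uniform d (T : measurableType d) (R : realType)
    (P : probability T R) (X : T -> R) (c : R) : Prop :=
  forall B : set (measurableTypeR R), measurable B ->
    P (X @^-1` B) =
    uniform_prob (gtrN (@ltr01 R)) ((fun u => c * u) @^-1` B).

(* Both kinds of coefficients are scaled by M 2^{-j(s + 1/2)}, with j = j0 for
   the alpha_k. *)
Definition wavelet_prior (R : realType) (b : cdv_basis R) (s M : R)
    (M0 : 0 < M)
    (P : probability (g_sigma_algebraType (coef_cylinders b s M0)) R) : Prop :=
  let X (i : wavelet_index (wj0 b)) (f : Cs_type b s M0) :=
    coef (Cs_val f) i in
  mutually_independent P X /\
  forall i, scaled_uniform P (X i)
    (M * 2 `^ (- ((index_level i)%:R * (s + 1 / 2)))).

(* Main.v *)
From HB Require Import structures.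
Require Import Defs.
From mathcomp Require Import all_boot all_order all_algebra finmap.
From mathcomp Require Import all_classical all_reals all_analysis.
From mathcomp Require Import measurable_realfun ring lra zify.

(** Fix one wavelet [psi_{j,0}] on each level [j >= j0]. If [f] is not
    self-similar then for every [eps] and [rho] there is a whole range of levels
    [j .. rho * j] on which the normalised coefficient
    [2^{j(s+1/2)} |beta_{j,0}|] is below [eps * M].

    (i) Such an [f] lies outside the set of those [f] for which these normalised
    coefficients are bounded away from [0] uniformly in [j]. That set is open,
    and dense because coefficients below [eta 2^{-j(s+1/2)}] may be moved by
    [2 eta 2^{-j(s+1/2)}], for any small [eta]: the correction has absolutely
    summable coefficients, hence is a function of L^2.

    (ii) Taking [eps = 1/2], independence gives each range of levels probability
    at most [2^{-(rho-1)j}], and the sum over [j >= j0 >= 1] tends to [0] as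
    [rho] tends to infinity. *)

Import Order.TTheory GRing.Theory Num.Theory.
Import numFieldNormedType.Exports.

Set Implicit Arguments.
Unset Strict Implicit.
Unset Printing Implicit Defensive.

Local Open Scope classical_set_scope.
Local Open Scope ring_scope.

(** * Linearity of [inner] on square-integrable functions, and passage between functions and
    classes *)

Section SquareIntegrable.
Context {R : realType} (mu : {measure set (measurableTypeR R) -> \bar R}).
Implicit Types f g h : R -> R.

Local Notation L2 := (Lfun mu 2%:E).

Lemma Lfun2_measurable f : f \in L2 ->
  measurable_fun setT (f : measurableTypeR R -> R).
Proof. by case/andP => /[!inE]. Qed.

Lemma Lfun2P f : measurable_fun setT (f : measurableTypeR R -> R) ->
  mu.-integrable setT (fun x => (f x ^+ 2)%:E) -> f \in L2.
Proof.
move=> mf /integrableP[_ f2]; apply/andP; split; rewrite inE//=.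
rewrite /finite_norm unlock poweR_lty//; apply: le_lt_trans f2.
rewrite le_eqVlt; apply/orP; left; apply/eqP/eq_integral => x _ /=.
by rewrite normrX powR_mulrn.
Qed.

Lemma integrable_mul f g : f \in L2 -> g \in L2 ->
  mu.-integrable setT (fun x => (f x * g x)%:E).
Proof. by move=> f2 g2; apply/Lfun1_integrable/Lfun2_mul_Lfun1. Qed.

Lemma Lfun2D f g : f \in L2 -> g \in L2 -> (fun x => f x + g x) \in L2.
Proof. exact: (Lfun_addr_closed mu (lee1n 2)).2. Qed.

Lemma Lfun2Z a f : f \in L2 -> (fun x => a * f x) \in L2.
Proof. 
move=> f2; rewrite (_ : (fun x => _) = a \o* f); first exact/Lfun_scale/f2/ler1n.
by apply/funext => x /=; rewrite mulrC.
Qed.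

Lemma Lfun2_0 : (fun _ : R => 0 : R) \in L2.
Proof. exact: (Lfun_addr_closed mu (lee1n 2)).1. Qed.

Lemma Lfun2_sum (I : eqType) (s : seq I) (F : I -> R -> R) :
  (forall i, i \in s -> F i \in L2) ->
  (fun x => \sum_(i <- s) F i x) \in L2.
Proof.
move=> F2; rewrite (_ : (fun x => _) = \sum_(i <- s) F i); last first.
  by apply/funext => x; rewrite fct_sumE.
by rewrite big_seq; elim/big_ind : _ => //; [exact: Lfun2_0 | exact: Lfun2D].
Qed.

Lemma innerD f g h : f \in L2 -> g \in L2 -> h \in L2 ->
  inner mu (fun x => f x + g x) h = inner mu f h + inner mu g h.
Proof.
move=> f2 g2 h2; rewrite /inner -RintegralD//; try exact: integrable_mul.
by apply: eq_Rintegral => x _; rewrite mulrDl.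
Qed.

Lemma innerZ a f h : f \in L2 -> h \in L2 ->
  inner mu (fun x => a * f x) h = a * inner mu f h.
Proof.
move=> f2 h2; rewrite /inner -RintegralZl//; last exact: integrable_mul.
by apply: eq_Rintegral => x _; rewrite mulrA.
Qed.

Lemma innerB f g h : f \in L2 -> g \in L2 -> h \in L2 ->
  inner mu (fun x => f x - g x) h = inner mu f h - inner mu g h.
Proof.
move=> f2 g2 h2; rewrite -mulN1r -innerZ// -innerD//; last exact: Lfun2Z.
by congr inner; apply/funext => x; rewrite mulN1r.
Qed.

Lemma inner_sum (I : eqType) (s : seq I) (F : I -> R -> R) h :
  (forall i, i \in s -> F i \in L2) -> h \in L2 ->
  inner mu (fun x => \sum_(i <- s) F i x) h = \sum_(i <- s) inner mu (F i) h.
Proof.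
move=> + h2; elim: s => [|i s IH] F2.
  rewrite big_nil /inner; under eq_Rintegral do rewrite big_nil mul0r.
  by rewrite Rintegral_cst// mul0r.
have Fs k : k \in s -> F k \in L2 by move=> ks; rewrite F2// inE ks orbT.
have Fi : F i \in L2 by rewrite F2// mem_head.
rewrite big_cons -IH// -innerD//; last exact: Lfun2_sum.
by congr inner; apply/funext => x; rewrite big_cons.
Qed.

Lemma ae_eq_inner f g h : f \in L2 -> g \in L2 -> h \in L2 ->
  ae_eq mu setT f g -> inner mu f h = inner mu g h.
Proof.
move=> f2 g2 h2 fg; rewrite /inner /Rintegral; congr fine.
apply: ae_eq_integral => //.
- exact: measurable_int (integrable_mul f2 h2).
- exact: measurable_int (integrable_mul g2 h2).
- by apply: filterS fg => x fgx xT; rewrite fgx.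
Qed.

Lemma Lspace_Lfun2 (f : LspaceType2 mu) : (f : R -> R) \in L2.
Proof.
apply/andP; split; rewrite inE/=; last exact: Lebesgue_finite.
exact: (measurable_funPT (repr (f : {mfun_ mu, measurableTypeR R >-> measurableTypeR R}))).
Qed.

(** Evaluating an element of [LspaceType2] picks a representative of its class, so [f] is recovered
    only almost everywhere; this is enough, as [inner] ignores null sets. *)
Lemma Lspace_of_Lfun2 f : f \in L2 ->
  exists F : LspaceType2 mu, ae_eq mu setT (F : R -> R) f.
Proof.
move=> f2; pose f' : {mfun measurableTypeR R >-> measurableTypeR R} :=
  HB.pack_for {mfun measurableTypeR R >-> measurableTypeR R} f
    (isMeasurableFun.Build _ _ (measurableTypeR R) (measurableTypeR R) f
      (Lfun2_measurable f2)).
pose q : {mfun_ mu, measurableTypeR R >-> measurableTypeR R} := (\pi_(_) f')%qT.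
have qf : ae_eq mu setT (q : R -> R) f.
  have /eqP := reprK q; rewrite eqmodE => /asboolP; exact.
have qn : finite_norm mu 2%:E (q : R -> R).
  rewrite /finite_norm; move: (f2) => /andP[_]; rewrite inE/= /finite_norm.
  apply: le_lt_trans; rewrite unlock /Lnorm.
  rewrite le_eqVlt; apply/orP; left; apply/eqP; congr (_ `^ _)%E.
  have mp (g : R -> R) : measurable_fun setT (g : measurableTypeR R -> R) ->
    measurable_fun setT (fun x : measurableTypeR R => (`|(EFin \o g) x| `^ 2)%E).
    move=> mg; apply/measurable_EFinP;
    apply: (@measurableT_comp _ _ _ _ _ _ (@powR R ^~ 2)) => //.
    exact: (@measurableT_comp _ _ _ _ _ _ (@Num.norm R R)).
  apply: ae_eq_integral => //.
  - by apply: mp; exact: (measurable_funPT (repr q)).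
  - by apply: mp; exact: Lfun2_measurable.
  - by apply: filterS qf => x qfx xT /=; rewrite qfx.
pose Q := HB.pack_for (LspaceType2 mu) q (isFinLebesgue.Build _ _ _ mu 2%:E (lee1n 2) q qn).
by exists Q.
Qed.
End SquareIntegrable.

(** Cauchy-Schwarz for the weights [|a k|]. In the induction step everything reduces to the cross
    term [2 X (a n) (b n)]. *)
Lemma sqr_sum_mul_le {R : realType} (a b : nat -> R) (n : nat) :
  (\sum_(k < n) a k * b k) ^+ 2 <=
  (\sum_(k < n) `|a k|) * (\sum_(k < n) `|a k| * b k ^+ 2).
Proof.
elim: n => [|n IH]; first by rewrite !big_ord0 expr0n mul0r.
rewrite !big_ord_recr/=.
set X := \sum_(i < n) a i * b i in IH *.
set A := \sum_(i < n) `|a i| in IH *.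
set B := \sum_(i < n) `|a i| * b i ^+ 2 in IH *.
have A0 : 0 <= A by apply: sumr_ge0.
have B0 : 0 <= B by apply: sumr_ge0 => i _; rewrite mulr_ge0// sqr_ge0.
have aa : `|a n| ^+ 2 = a n ^+ 2 by rewrite real_normK// num_real.
suff XY : 2 * (X * (a n * b n)) <= `|a n| * (A * b n ^+ 2 + B).
  rewrite (_ : (_ + _) * _ = A * B + `|a n| * (A * b n ^+ 2 + B) +
    `|a n| ^+ 2 * b n ^+ 2); last by ring.
  by rewrite aa; nra.
have XYn : X * (a n * b n) <= `|a n| * (`|X| * `|b n|).
  by rewrite (le_trans (ler_norm _))// !normrM; lra.
suff : 2 * (`|X| * `|b n|) <= A * b n ^+ 2 + B.
  by have := normr_ge0 (a n); nra.
(* If [A = 0], the induction hypothesis forces [X = 0]. Otherwise multiply by [A]: the bound follows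
   from [(A |b n| - |X|)^2 >= 0] and [X^2 <= A * B]. *)
have [A00|A00] := eqVneq A 0.
  have -> : X = 0.
    by apply/eqP; rewrite -sqrf_eq0 eq_le sqr_ge0 andbT (le_trans IH)// A00 mul0r.
  by rewrite normr0 mul0r mulr0 A00 mul0r add0r.
have Ap : 0 < A by rewrite lt_def A00.
rewrite -(ler_pM2l Ap).
have X2 : `|X| ^+ 2 <= A * B by rewrite real_normK ?num_real.
rewrite -(@real_normK _ (b n)) ?num_real//.
have := sqr_ge0 (A * `|b n| - `|X|).
by nra.
Qed.

(** * A Riesz-Fischer theorem for absolutely summable coefficients *)

Section OrthonormalSeries.
Context {R : realType} (mu : {measure set (measurableTypeR R) -> \bar R}).
Variables (I : eqType) (e : I -> R -> R) (u : nat -> I) (c : nat -> R) (C : R).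
Hypothesis e_on : orthonormal_family mu e.
Hypothesis u_inj : injective u.
Hypothesis c_sum : forall n, \sum_(k < n) `|c k| <= C.

Local Notation L2 := (Lfun mu 2%:E).

Let e2 i : e i \in L2. Proof. by case: e_on. Qed.

Let me i : measurable_fun setT (e i : measurableTypeR R -> R).
Proof. exact: Lfun2_measurable (e2 i). Qed.

Let S n x := \sum_(k < n) c k * e (u k) x.

(* By the weighted Cauchy-Schwarz inequality [S n ^+ 2 <= C * H], so that [C * H]
   dominates all the partial sums in mean square. *)
Let H (x : R) := (\sum_(k <oo) (`|c k| * e (u k) x ^+ 2)%:E)%E.

Let S2 n : S n \in L2.
Proof. by apply: Lfun2_sum => i _; exact: Lfun2Z. Qed.

Let H_term_ge0 n x : (0 <= (`|c n| * e (u n) x ^+ 2)%:E)%E.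
Proof. by rewrite lee_fin mulr_ge0// sqr_ge0. Qed.

Let mH : measurable_fun setT (H : measurableTypeR R -> \bar R).
Proof.
apply: (@ge0_emeasurable_sum _ (measurableTypeR R) R setT
  (fun n x => (`|c n| * e (u n) x ^+ 2)%:E) xpredT).
- by move=> k x _ _; exact: H_term_ge0.
- move=> k _; apply/measurable_EFinP; apply: measurable_funM => //.
  exact: measurable_funX.
Qed.

(** Sum and integral of nonnegative terms commute, and each [e (u k)] has norm 1, so the integral of
    [H] is the sum of the [|c k|], at most [C]. *)
Let iH : mu.-integrable setT (H : measurableTypeR R -> \bar R).
Proof.
apply/integrableP; split => //.
under eq_integral => x _ do rewrite gee0_abs ?nneseries_ge0//.
rewrite integral_nneseries//; last first.
  move=> k; apply/measurable_EFinP; apply: measurable_funM => //.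
  exact: measurable_funX.
apply: (@le_lt_trans _ _ C%:E); last exact: ltry.
apply: lime_le.
  by apply: is_cvg_nneseries => n _ _; apply: integral_ge0 => x _.
apply: nearW => n; rewrite big_mkord.
rewrite (eq_bigr (fun k : 'I_n => (`|c k|)%:E)); first by rewrite sumEFin lee_fin c_sum.
move=> k _; under eq_integral do rewrite EFinM.
rewrite ge0_integralZl//; last 2 first.
- by apply/measurable_EFinP; exact: measurable_funX.
- by move=> x _; rewrite lee_fin sqr_ge0.
have := e_on.2 (u k) (u k); rewrite eqxx mulr1n /inner /Rintegral => ek.
rewrite (_ : (\int[mu]_x _)%E = 1%E) ?mule1//.
rewrite -[RHS]/(1%R%:E) -ek fineK; last exact/integrable_fin_num/integrable_mul.
by apply: eq_integral => x _; rewrite expr2.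
Qed.

Let H_fin x : H x \is a fin_num ->
  forall n, \sum_(k < n) `|c k| * e (u k) x ^+ 2 <= fine (H x).
Proof.
move=> Hx n; rewrite -lee_fin fineK// -sumEFin.
have := @nneseries_lim_ge R (fun k => (`|c k| * e (u k) x ^+ 2)%:E) xpredT 0 n.
by rewrite big_mkord; apply => k _ _.
Qed.

Let C_ge0 : 0 <= C.
Proof. by have := c_sum 0; rewrite big_ord0. Qed.

Let S_sqr x n : H x \is a fin_num -> S n x ^+ 2 <= C * fine (H x).
Proof.
move=> Hx; apply: (le_trans (sqr_sum_mul_le c (fun k => e (u k) x) n)).
apply: ler_pM => //; [exact: sumr_ge0| |exact: H_fin].
by apply: sumr_ge0 => i _; rewrite mulr_ge0// sqr_ge0.
Qed.

Let S_cvg x : H x \is a fin_num -> cvgn (S ^~ x).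
Proof.
move=> Hx; have -> : S ^~ x = series (fun k => c k * e (u k) x).
  by apply/funext => n; rewrite /S /series/= big_mkord.
apply: normed_cvg; apply: nondecreasing_is_cvgn.
  by apply: nondecreasing_series => k _ _; exact: normr_ge0.
(* Absolute convergence: [|y| <= 1 + y^2] bounds each term by [|c k|] plus the corresponding term of
   [H]. *)
exists (C + fine (H x)) => _ [n _ <-] /=; rewrite /series/= big_mkord.
apply: le_trans (lerD (c_sum n) (H_fin Hx n)).
rewrite -big_split/=; apply: ler_sum => k _.
rewrite normrM -[X in _ <= X + _]mulr1 -mulrDr ler_wpM2l//.
rewrite -(@real_normK _ (e _ _)) ?num_real//.
by have := normr_ge0 (e (u k) x); nra.
Qed.

(** An upper limit is measurable with no convergence assumption; where [H x] is finite, hence almost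
    everywhere, it is the limit of [S n x]. *)
Let h (x : R) : R := fine (limn_esup (fun n => (S n x)%:E)).

Let mh : measurable_fun setT (h : measurableTypeR R -> R).
Proof.
apply: (@measurableT_comp _ _ _ _ _ _ (@fine R)) => //.
apply: measurable_fun_limn_esup => n; apply/measurable_EFinP.
exact: Lfun2_measurable (S2 n).
Qed.

Let S_h x : H x \is a fin_num -> S n x @[n --> \oo] --> h x.
Proof.
move=> Hx; have /cvg_ex[l Sl] := S_cvg Hx.
suff -> : h x = l by [].
rewrite /h limn_esup_lim.
suff /cvg_lim -> // : esups (fun n => (S n x)%:E) @ \oo --> l%:E by [].
by apply: cvg_esups; apply: cvg_EFin => //; exact: nearW.
Qed.

Let H_ae : {ae mu, forall x, H x \is a fin_num}.
Proof.
have := integrable_ae (@measurableT _ (measurableTypeR R)) iH.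
by apply: filterS => x; exact.
Qed.

(** Dominated convergence for [S n ^+ 2] under [C * H]; only the integrability of the limit is
    kept. *)
Let h2 : h \in L2.
Proof.
apply: Lfun2P => //.
have [] := @dominated_convergence _ (measurableTypeR R) R mu setT measurableT
  (fun n x => (S n x ^+ 2)%:E) (fun x => (h x ^+ 2)%:E) (fun x => C%:E * H x)%E => //.
- move=> n; apply/measurable_EFinP; apply: measurable_funX.
  exact: Lfun2_measurable (S2 n).
- by apply/measurable_EFinP; exact: measurable_funX.
- apply: (@filterS _ _ (ae_filter_ringOfSetsType mu) _ _ _ H_ae) => x Hx _.
  apply: cvg_EFin; first exact: nearW.
  by under eq_fun do rewrite expr2; rewrite expr2; apply: cvgM; exact: S_h.
- exact: integrableZl.
- apply: (@filterS _ _ (ae_filter_ringOfSetsType mu) _ _ _ H_ae) => x Hx n _ /=.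
  rewrite ger0_norm ?sqr_ge0// -(fineK Hx) -EFinM lee_fin; exact: S_sqr.
Qed.

Let inner_S n t :
  inner mu (S n) (e t) = \sum_(k < n) c k * (u k == t)%:R.
Proof.
rewrite inner_sum//; last by move=> k _; exact: Lfun2Z.
by apply: eq_bigr => k _; rewrite innerZ// e_on.2.
Qed.

(** Dominated convergence again, with [|S n * e t| <= C * H + e t ^+ 2]. *)
Let inner_cvg t : inner mu (S n) (e t) @[n --> \oo] --> inner mu h (e t).
Proof.
suff [_ _ cv] : [/\ mu.-integrable setT (fun x : measurableTypeR R => (h x * e t x)%:E),
    [sequence \int[mu]_x `|(S n x * e t x)%:E - (h x * e t x)%:E|]_n @ \oo --> 0 &
    [sequence \int[mu]_x (S n x * e t x)%:E]_n @ \oo -->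
      \int[mu]_x (h x * e t x)%:E]%E.
  apply: fine_cvg; rewrite fineK//.
  exact/integrable_fin_num/integrable_mul.
apply: (@dominated_convergence _ (measurableTypeR R) R mu setT measurableT _ _
  (fun x => C%:E * H x + (e t x ^+ 2)%:E)%E).
- by move=> n; exact: measurable_int (integrable_mul (S2 n) (e2 t)).
- exact: measurable_int (integrable_mul h2 (e2 t)).
- apply: (@filterS _ _ (ae_filter_ringOfSetsType mu) _ _ _ H_ae) => x Hx _.
  apply: cvg_EFin; first exact: nearW.
  by apply: cvgM; [exact: S_h | exact: cvg_cst].
- apply: integrableD => //; first exact: integrableZl.
  exact: Lfun2_integrable_sqr.
- apply: (@filterS _ _ (ae_filter_ringOfSetsType mu) _ _ _ H_ae) => x Hx n _ /=.
  rewrite -(fineK Hx) -EFinM -EFinD lee_fin.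
  have := S_sqr n Hx; rewrite normrM.
  rewrite -(@real_normK _ (e t x)) ?num_real// -(@real_normK _ (S n x)) ?num_real//.
  by have := normr_ge0 (e t x); have := normr_ge0 (S n x); nra.
Qed.

(** By orthonormality the inner product of [S n] with a fixed [e t] is eventually constant in [n],
    and [inner_cvg] carries this constant to [h]. *)
Lemma orthonormal_series : exists h : R -> R,
  [/\ h \in L2, forall n, inner mu h (e (u n)) = c n &
      forall t, (forall n, t != u n) -> inner mu h (e t) = 0].
Proof.
exists h; split=> // [m|t tu].
- rewrite -(cvg_lim (@Rhausdorff R) (@inner_cvg (u m))); apply: cvg_lim => //.
  (* The term of index [m] occurs in [S n] exactly when [n > m]. *)
  apply: cvg_near_cst; exists m.+1 => // n /= mn.
  rewrite inner_S (bigD1 (Ordinal mn))//= eqxx mulr1 big1 ?addr0// => k km.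
  rewrite (inj_eq u_inj) (_ : (k == m :> nat) = false) ?mulr0//.
  by apply: contraNF km => /eqP km; apply/eqP/val_inj.
- rewrite -(cvg_lim (@Rhausdorff R) (@inner_cvg t)); apply: cvg_lim => //.
  apply: cvg_near_cst; apply: nearW => n; rewrite inner_S big1// => k _.
  by rewrite eq_sym (negbTE (tu k)) mulr0.
Qed.

End OrthonormalSeries.

(** * Wavelet coefficients, the norm of C^s and the blocks f_{i,j} *)

Section WaveletCoefficients.
Context {R : realType} (b : cdv_basis R).
Local Notation mu := (leb01 R).
Local Notation L2 := (Lfun (leb01 R) 2%:E).
Local Notation j0 := (wj0 b).
Local Notation W := (wavelet_index (wj0 b)).
Local Notation basis := (interval_basis (j0 := wj0 b) (phijk b) (psijk b)).
Implicit Types (f g : R -> R) (t : W).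

Lemma basis_orthonormal : orthonormal_family mu basis.
Proof. by case: (wbasis b). Qed.

Lemma basis_Lfun2 t : basis t \in L2.
Proof. by case: basis_orthonormal. Qed.

Definition coef_weight (s : R) t : R :=
  match t with inl _ => 1 | inr p => 2 `^ ((j0 + tag p)%:R * (s + 1 / 2)) end.

Lemma coef_weight_gt0 s t : 0 < coef_weight s t.
Proof. by case: t => [k|p] //=; exact: powR_gt0. Qed.

(** Merging the two suprema into one over the index type makes bounds on the norm, and later its
    measurability, a matter of single coefficients. *)
Lemma Cs_normE s f :
  Cs_norm b s f = ereal_sup (range (fun t => (coef_weight s t * `|coef f t|)%:E)).
Proof.
apply/eqP; rewrite eq_le; apply/andP; split.
  rewrite /Cs_norm ge_max; apply/andP; split; apply: ge_ereal_sup.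
    move=> _ [k /= kj <-]; apply: ereal_sup_ubound; exists (inl (Ordinal kj)) => //.
    by rewrite /= mul1r.
  move=> _ [[l k] /= [jl kl] <-]; apply: ereal_sup_ubound.
  rewrite -(subnKC jl) in kl *.
  by exists (inr (Tagged (fun i => 'I_(2 ^ (j0 + i))) (Ordinal kl))).
apply: ge_ereal_sup => _ [[k|[i k]] _ <-]; rewrite /Cs_norm le_max; apply/orP.
  left; apply: ereal_sup_ubound; exists (k : nat) => /=; first exact: ltn_ord.
  by rewrite mul1r.
right; apply: ereal_sup_ubound; exists ((j0 + i)%N, k : nat) => //=.
by rewrite leq_addr ltn_ord.
Qed.

Lemma Cs_norm_le s f (x : \bar R) :
  (forall t, ((coef_weight s t * `|coef f t|)%:E <= x)%E) -> (Cs_norm b s f <= x)%E.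
Proof. by move=> fx; rewrite Cs_normE; apply: ge_ereal_sup => _ [t _ <-]. Qed.

Lemma le_Cs_norm s f t : ((coef_weight s t * `|coef f t|)%:E <= Cs_norm b s f)%E.
Proof. by rewrite Cs_normE; apply: ereal_sup_ubound; exists t. Qed.

Lemma coefB f g t : f \in L2 -> g \in L2 ->
  coef (fun x => f x - g x) t = coef f t - coef g t.
Proof. by move=> f2 g2; rewrite /coef innerB// basis_Lfun2. Qed.

Lemma psijk_Lfun2 l k : (j0 <= l)%N -> (k < 2 ^ l)%N -> psijk b l k \in L2.
Proof.
move=> jl; rewrite -(subnKC jl) => kl.
exact: (basis_Lfun2 (inr (Tagged (fun i => 'I_(2 ^ (j0 + i))) (Ordinal kl)))).
Qed.

Lemma phijk_Lfun2 k : (k < 2 ^ j0)%N -> phijk b j0 k \in L2.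
Proof. by move=> kj; exact: (basis_Lfun2 (inl (Ordinal kj))). Qed.

Lemma inner_phijk k t : (k < 2 ^ j0)%N ->
  inner mu (phijk b j0 k) (basis t) = (if t is inl k' then k == k' else false)%:R.
Proof.
move=> kj; rewrite (basis_orthonormal.2 (inl (Ordinal kj)) t).
by case: t.
Qed.

Lemma inner_psijk l k t : (j0 <= l)%N -> (k < 2 ^ l)%N ->
  inner mu (psijk b l k) (basis t) =
  (if t is inr p then (l == j0 + tag p)%N && (k == tagged p :> nat) else false)%:R.
Proof.
move=> jl; rewrite -(subnKC jl); move: (l - j0)%N => {jl} {}l kl.
rewrite (basis_orthonormal.2 (inr (Tagged (fun i => 'I_(2 ^ (j0 + i))) (Ordinal kl))) t).
case: t => [//|[l' k']]; congr (nat_of_bool _)%:R.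
rewrite -[tag _]/l' -[tagged _]/k' eqn_add2l.
apply/eqP/andP => [E|[/eqP ll /eqP kk]].
  (* The position has a type depending on the level; projecting to a pair of natural numbers avoids
     a dependent equality. *)
  have := congr1 (fun t : W =>
    if t is inr p then (tag p, nat_of_ord (tagged p)) else (0, 0)%N) E.
  by case=> -> ->; rewrite !eqxx.
by case: l' / ll k' kk => k' kk; congr (inr (Tagged _ _)); exact: val_inj.
Qed.

Definition block_active (i j : nat) t : bool :=
  match t with inl _ => i == j0 | inr p => (i <= j0 + tag p <= j)%N end.

(** Each basis function in the sums is orthogonal to all others, so only the term of index [t], if
    present, survives. The bound [j0 <= i] ensures that every wavelet in the block belongs to the
    basis. *)
Lemma coef_block f i j t : (j0 <= i)%N ->
  coef (block b f i j) t = if block_active i j t then coef f t else 0.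
Proof.
move=> ji; rewrite /coef.
have t2 := basis_Lfun2 t.
have phi2 k : k \in index_iota 0 (2 ^ j0) ->
    (fun x => alpha b f k * phijk b j0 k x) \in L2.
  by rewrite mem_index_iota => kj; apply/Lfun2Z/phijk_Lfun2.
have psi2 l k : l \in index_iota i j.+1 -> k \in index_iota 0 (2 ^ l) ->
    (fun x => beta b f l k * psijk b l k x) \in L2.
  rewrite !mem_index_iota => /andP[il _] kl; apply/Lfun2Z/psijk_Lfun2 => //.
  exact: leq_trans il.
have A2 : (fun x => if i == j0 then
    \sum_(0 <= k < 2 ^ j0) alpha b f k * phijk b j0 k x else 0) \in L2.
  by case: eqP => _; [exact: Lfun2_sum | exact: Lfun2_0].
rewrite innerD//; last first.
  by apply: Lfun2_sum => l li; apply: Lfun2_sum => k; exact: psi2.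
rewrite inner_sum//; last by move=> l li; apply: Lfun2_sum => k; exact: psi2.
(* Inner products become indicators; the sums over levels and positions then collapse to at most one
   term. *)
rewrite [X in _ + X](_ : _ = \sum_(i <= l < j.+1) \sum_(0 <= k < 2 ^ l)
    beta b f l k * (if t is inr p then (l == j0 + tag p)%N && (k == tagged p :> nat)
                    else false)%:R); last first.
  apply: eq_big_seq => l li; rewrite inner_sum//; last by move=> k; exact: psi2.
  apply: eq_big_seq => k kl; rewrite innerZ//; last first.
    move: li kl; rewrite !mem_index_iota => /andP[il _] kl.
    by apply: psijk_Lfun2 => //; exact: leq_trans il.
  rewrite inner_psijk//; first by move: li; rewrite mem_index_iota => /andP[/(leq_trans ji)].
  by move: kl; rewrite mem_index_iota.
rewrite [X in X + _](_ : _ = if i == j0 then \sum_(0 <= k < 2 ^ j0)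
    alpha b f k * (if t is inl k' then k == k' else false)%:R else 0); last first.
  case: eqP => _; last first.
    rewrite /inner; under eq_Rintegral do rewrite mul0r.
    by rewrite Rintegral_cst// mul0r.
  rewrite inner_sum//; apply: eq_big_seq => k kj.
  have kj' : (k < 2 ^ j0)%N by move: kj; rewrite mem_index_iota.
  by rewrite innerZ ?inner_phijk ?phijk_Lfun2.
case: t t2 => [k|[l k]] t2 /=.
  rewrite [X in _ + X]big1 ?addr0; last first.
    by move=> l _; rewrite big1// => k' _; rewrite mulr0.
  case: eqP => // _; under eq_bigr => k' _ do rewrite mulr_natr mulrb.
  by rewrite -big_mkcond big_nat1_eq/= ltn_ord.
rewrite [X in X + _](_ : _ = 0) ?add0r; last first.
  by case: ifP => // _; rewrite big1// => k' _; rewrite mulr0.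
rewrite (eq_bigr (fun l' => if l' == (j0 + l)%N then
    \sum_(0 <= k' < 2 ^ l' | k' == k) beta b f l' k' else 0)); last first.
  move=> l' _; case: eqP => _ /=; last by rewrite big1// => k' _; rewrite mulr0.
  rewrite [RHS]big_mkcond; apply: eq_bigr => k' _.
  by rewrite mulr_natr mulrb.
rewrite -big_mkcond big_nat1_eq ltnS; case: ifP => // _.
by rewrite big_nat1_eq/= ltn_ord.
Qed.

End WaveletCoefficients.

(** * Nowhere density of the functions that are not self-similar *)

Section SelfSimilarity.
Context {R : realType} (b : cdv_basis R) (smax s M : R).
Hypothesis M0 : 0 < M.
Local Notation mu := (leb01 R).
Local Notation L2 := (Lfun (leb01 R) 2%:E).
Local Notation j0 := (wj0 b).
Local Notation W := (wavelet_index (wj0 b)).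
Local Notation T := (Cs_type b s M0).
Local Notation D :=
  ((@Cs_val R b s M M0) @^-1` not_self_similar b smax s M : set T).

(** The index of [psi_{j0+i,0}]: levels are counted from [j0]. *)
Definition first_index (i : nat) : W :=
  inr (Tagged (fun i => 'I_(2 ^ (j0 + i))) (Ordinal (expn_gt0 2 (j0 + i)))).

Lemma first_index_inj : injective first_index.
Proof.
move=> i i' E.
exact: (congr1 (fun t : W => if t is inr p then tag p else 0%N) E).
Qed.

Definition scaled_coef (t : W) (f : T) : R :=
  coef_weight s t * `|coef (Cs_val f) t|.

Definition large (eps : R) (rho j : nat) (f : T) : Prop :=
  ((eps * M)%:E <= Cs_norm b s (block b (Cs_val f) j (rho * j)))%E.

Lemma scaled_coef_le_block (f : T) j rho i : (j0 <= j)%N ->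
  (j <= j0 + i <= rho * j)%N ->
  ((scaled_coef (first_index i) f)%:E <=
    Cs_norm b s (block b (Cs_val f) j (rho * j)))%E.
Proof.
move=> jj ji; apply: le_trans (le_Cs_norm s _ (first_index i)).
by rewrite coef_block//= ji.
Qed.

Lemma DP (f : T) : D f <->
  forall eps rho, 0 < eps < 1 -> (0 < rho)%N ->
    ~ (if s < smax then forall j, (j0 <= j)%N -> large eps rho j f
       else large eps rho j0 f).
Proof.
have fM : Cs b s M (Cs_val f) by exact: (set_valP f).
split.
  case=> _ nf eps rho e01 r0 lf; apply: nf.
  by exists eps => //=; exists rho.
move=> nf; split=> // -[eps /=]; rewrite in_itv/= => e01 [rho r0 [_ lf]].
exact: nf eps rho e01 r0 lf.
Qed.

(** A block norm below [eps * M] bounds every scaled coefficient in the block. For [s < smax] some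
    level [j] fails the block inequality; otherwise it fails at [j0]. *)
Lemma D_small_levels (f : T) eps rho : D f -> 0 < eps < 1 -> (0 < rho)%N ->
  exists2 j, (j0 <= j)%N & forall i, (j <= j0 + i <= rho * j)%N ->
    scaled_coef (first_index i) f < eps * M.
Proof.
move=> /DP nf e01 r0; have /= := nf _ _ e01 r0.
have small j : (j0 <= j)%N -> ~ large eps rho j f ->
    forall i, (j <= j0 + i <= rho * j)%N ->
      scaled_coef (first_index i) f < eps * M.
  move=> jj /negP; rewrite -ltNge => lf i ji; rewrite -lte_fin.
  exact: le_lt_trans (scaled_coef_le_block f jj ji) lf.
case: ifP => _ lf; last by exists j0 => //; exact: small.
apply: contrapT => nj; apply: lf => j jj; apply: contrapT => lj.
by apply: nj; exists j => //; exact: small.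
Qed.

(** The open dense set that avoids [D]. *)
Definition uniformly_large : set T :=
  [set f | exists2 d, 0 < d & forall i, d <= scaled_coef (first_index i) f].

(** The norm controls all scaled coefficients at once: a move of less than [d / 2] leaves each at
    least [d / 2]. *)
Lemma uniformly_large_open : open uniformly_large.
Proof.
move=> f [d d0 df]; exists (d / 2); first by rewrite divr_gt0.
move=> g fg; exists (d / 2); first by rewrite divr_gt0.
move=> i; have := le_lt_trans (le_Cs_norm s _ (first_index i)) fg.
rewrite lte_fin coefB; [|exact: Lspace_Lfun2..].
rewrite /scaled_coef; set w := coef_weight _ _ => fgi.
have := df i; rewrite /scaled_coef -/w => dfi.
have w0 : 0 <= w by rewrite ltW// coef_weight_gt0.
have := ler_wpM2l w0 (lerB_dist
  (coef (Cs_val f) (first_index i)) (coef (Cs_val g) (first_index i))).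
by rewrite mulrBr; lra.
Qed.

Lemma uniformly_large_disjoint : D `<=` ~` uniformly_large.
Proof.
move=> f Df [d d0 df].
(* With [rho = 1] the range is the single level [j]. The minimum keeps [eps] below 1 and gives
   [eps * M <= d]. *)
have [||j jj sj] := @D_small_levels f (Num.min (d / M) (1 / 2)) 1 Df.
- by rewrite lt_min gt_min divr_gt0//=; lra.
- by [].
have := sj (j - j0)%N; rewrite subnKC// mul1n leqnn => /(_ isT).
apply/negP; rewrite -leNgt; apply: le_trans (df _).
by rewrite -ler_pdivlMr// ge_min lexx.
Qed.

Hypothesis s0 : 0 < s.

(** Geometric decay in [i], which makes the correction in the density argument absolutely
    summable. *)
Lemma coef_weight_first_le i :
  (coef_weight s (first_index i))^-1 <= (2 `^ (- (s + 1 / 2))) ^+ i.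
Proof.
rewrite /= -powRN -powR_mulrn ?powR_ge0// -powRrM ler_powR ?ler1n//.
rewrite natrD mulrC -mulNr ler_nM2l ?oppr_lt0 ?lerDr//.
by rewrite addr_gt0// divr_gt0.
Qed.

Lemma uniformly_large_dense (f : T) (r : R) : 0 < r ->
  exists2 g : T, Cs_ball f r g & uniformly_large g.
Proof.
move=> r0.
(* [2 * eta < r] keeps the perturbed function in the ball, and [3 * eta <= M] keeps it in C^s(M). *)
have [eta [eta0 etar etaM]] : exists eta, [/\ 0 < eta, 2 * eta < r & 3 * eta <= M].
  have [m [m0 mr mM]] : exists m, [/\ 0 < m, m <= r & m <= M].
    by exists (Num.min r M); rewrite lt_min r0 M0 !ge_min !lexx orbT.
  by exists (m / 4); split; lra.
pose w i := coef_weight s (first_index i).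
have w0 i : 0 < w i by exact: coef_weight_gt0.
(* A scaled coefficient below [eta] is shifted by [2 * eta], so its new size lies between [eta] and
   [3 * eta]; the others stay. *)
pose c i := if scaled_coef (first_index i) f < eta then 2 * eta / w i else 0.
have c0 i : 0 <= c i.
  by rewrite /c; case: ifP => // _; rewrite divr_ge0 ?mulr_ge0 ?ltW.
pose q : R := 2 `^ (- (s + 1 / 2)).
have q0 : 0 < q by exact: powR_gt0.
have q1 : q < 1.
  have a0 : 0 < s + 1 / 2 by rewrite addr_gt0// divr_gt0.
  have : (1 : R) `^ (s + 1 / 2) < 2 `^ (s + 1 / 2).
    by rewrite gt0_ltr_powR// ?nnegrE// ltr1n.
  by rewrite powR1 /q powRN invf_lt1 ?powR_gt0.
have c_sum n : \sum_(k < n) `|c k| <= 2 * eta / (1 - q).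
  have /= := @geometric_le_lim R n (2 * eta) q.
  have eta20 : 0 <= 2 * eta by rewrite mulr_ge0// ltW.
  rewrite gtr0_norm// => /(_ eta20 q0 q1).
  apply: le_trans; rewrite /series/= big_mkord; apply: ler_sum => k _.
  rewrite ger0_norm//; apply: le_trans (_ : 2 * eta / w k <= _).
    by rewrite /c; case: ifP => // _; rewrite divr_ge0 ?mulr_ge0 ?ltW.
  by rewrite ler_pM2l ?mulr_gt0//; exact: coef_weight_first_le.
have [h [h2 hc hN]] := orthonormal_series (basis_orthonormal b) first_index_inj c_sum.
have f2 : (Cs_val f : R -> R) \in L2 by exact: Lspace_Lfun2.
(* [G] is the class of [f + h], where [h] has coefficients [c i] at [first_index i] and 0
   elsewhere. *)
have [G Gfh] := Lspace_of_Lfun2 (Lfun2D f2 h2).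
have Gcoef (t : W) : coef G t =
    coef (Cs_val f) t + inner mu h (interval_basis (phijk b) (psijk b) t).
  rewrite /coef (ae_eq_inner _ _ _ Gfh) ?Lspace_Lfun2 ?basis_Lfun2//; last exact: Lfun2D.
  by rewrite innerD// basis_Lfun2.
have fM t : scaled_coef t f <= M.
  rewrite -lee_fin; apply: le_trans (set_valP f : Cs b s M (Cs_val f)).
  exact: le_Cs_norm.
have cE i : coef_weight s (first_index i) * c i =
    if scaled_coef (first_index i) f < eta then 2 * eta else 0.
  by rewrite /c; case: ifP => _; rewrite ?mulr0// mulrC divfK// gt_eqF.
have weighted i : eta <= w i * `|coef (Cs_val f) (first_index i) + c i| <= M.
  have := fM (first_index i); have := cE i; have := c0 i.
  rewrite /c; case: ifPn => [|fi _ _]; last first.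
    by rewrite addr0 -[w i * _]/(scaled_coef _ f) => ->; rewrite leNgt fi.
  move: (2 * eta / w i) => a; rewrite /scaled_coef -/(w i).
  move: (coef _ _) (w i) (w0 i) => x y y0 xe a0 ya _.
  have -> : y * `|x + a| = `|y * x + 2 * eta|.
    by rewrite -ya -mulrDr normrM (gtr0_norm y0).
  move: xe; rewrite -{1}(gtr0_norm y0) -normrM ltr_norml => /andP[? ?].
  by rewrite ger0_norm; lra.
have GM : Cs b s M G.
  apply: Cs_norm_le => t; rewrite lee_fin Gcoef.
  have [[i ->]|nt] := pselect (exists i, t = first_index i).
    by rewrite hc; have /andP[] := weighted i.
  rewrite hN ?addr0; first exact: fM.
  by move=> i; apply/eqP => ti; apply: nt; exists i.
pose g : T := exist _ G (mem_set GM).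
exists g; last by exists eta => // i;
  rewrite /scaled_coef Gcoef hc; have /andP[] := weighted i.
apply: (@le_lt_trans _ _ (2 * eta)%:E); last by rewrite lte_fin.
apply: Cs_norm_le => t; rewrite coefB ?Lspace_Lfun2// Gcoef opprD addNKr normrN lee_fin.
have [[i ->]|nt] := pselect (exists i, t = first_index i).
  rewrite hc ger0_norm// cE; case: ifP => // _; lra.
rewrite hN; first by rewrite normr0 mulr0; lra.
by move=> i; apply/eqP => ti; apply: nt; exists i.
Qed.

(** A ball inside the closure of [D] would contain a point of the dense set [uniformly_large], which
    is open and so would meet [D]. *)
Lemma D_nowhere_dense : nowhere_dense D.
Proof.
rewrite /nowhere_dense -subset0 => f Df.
have [B [oB Bf BD]] : nbhs f (closure D) by [].
have [r r0 rB] := oB f Bf.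
have [g fg Ug] := uniformly_large_dense f r0.
have [h [Dh Uh]] := BD _ (rB _ fg) uniformly_large
  (open_nbhs_nbhs (conj uniformly_large_open Ug)).
exact: uniformly_large_disjoint Dh Uh.
Qed.

End SelfSimilarity.

(** A supremum need not be attained; this form expresses a lower bound on it by countably many
    strict inequalities, for use in measurability. *)
Lemma ereal_sup_geP {R : realType} (S : set \bar R) (c : R) :
  (c%:E <= ereal_sup S)%E <->
  forall n, exists2 y, S y & ((c - n.+1%:R^-1)%:E < y)%E.
Proof.
split=> [cS n|cS].
  by apply: ereal_sup_gt; apply: lt_le_trans cS; rewrite lte_fin gtrBl invr_gt0.
rewrite leNgt; apply/negP => Sc.
suff [n Sn] : exists n, (ereal_sup S <= (c - n.+1%:R^-1)%:E)%E.
  have [y Sy] := cS n; apply/negP; rewrite -leNgt; apply: le_trans Sn.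
  exact: ereal_sup_ubound.
case: (ereal_sup S) Sc => [r| |] //.
  rewrite lte_fin => /ltr_add_invr[n rn]; exists n.
  by rewrite lee_fin lerBrDr ltW.
by exists 0; rewrite leNye.
Qed.

Lemma uniform_prob_half {R : realType} :
  uniform_prob (gtrN (@ltr01 R)) `](- (1 / 2)), (1 / 2)[%classic = (1 / 2)%:E.
Proof.
rewrite /uniform_prob (eq_integral (cst (1 / 2)%:E)); last first.
  move=> x; rewrite inE/= in_itv/= => /andP[x1 x2].
  by rewrite /uniform_pdf ifT; [rewrite opprK div1r | apply/andP; split; lra].
rewrite integral_cst//= lebesgue_measure_itv/= lte_fin ifT; last by lra.
by rewrite -EFinD -EFinM; congr (_%:E); field.
Qed.

(** * Measurability of the exceptional set and its prior probability *)

Section Measurability.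
Context {R : realType} (b : cdv_basis R) (smax s M : R).
Hypothesis M0 : 0 < M.
Local Notation j0 := (wj0 b).
Local Notation W := (wavelet_index (wj0 b)).
Local Notation T := (g_sigma_algebraType (coef_cylinders b s M0)).
Local Notation D :=
  ((@Cs_val R b s M M0) @^-1` not_self_similar b smax s M : set T).

Lemma measurable_coef (t : W) :
  measurable_fun setT (fun f : T => coef (Cs_val (f : Cs_type b s M0)) t : measurableTypeR R).
Proof.
move=> _ B mB; rewrite setTI; apply: sub_sigma_algebra.
by exists t, B.
Qed.

Lemma countable_wavelet_index : countable [set: W].
Proof.
exact: (@countableP ('I_(2 ^ j0) + {i : nat & 'I_(2 ^ (j0 + i))})%type).
Qed.

Lemma measurable_large eps rho j : (j0 <= j)%N ->
  measurable (large (b := b) (s := s) (M0 := M0) eps rho j : set T).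
Proof.
move=> jj; pose v (t : W) (f : T) : R := coef_weight s t *
  `|if block_active j (rho * j) t then coef (Cs_val (f : Cs_type b s M0)) t else 0|.
have -> : large (b := b) (s := s) (M0 := M0) eps rho j =
    \bigcap_n \bigcup_(t in [set: W]) [set f | eps * M - n.+1%:R^-1 < v t f].
  apply/seteqP; split=> f; rewrite /large /= Cs_normE.
    move=> /ereal_sup_geP + n _ => /(_ n)[_ [t _ <-]].
    by rewrite lte_fin coef_block ?Lspace_Lfun2// => vt; exists t.
  move=> vf; apply/ereal_sup_geP => n; have [t _ vt] := vf n I.
  exists (v t f)%:E; last by rewrite lte_fin.
  by exists t => //; rewrite coef_block ?Lspace_Lfun2.
apply: bigcap_measurableType => n _.
apply: countable_bigcupT_measurable; first exact: countable_wavelet_index.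
move=> t; rewrite -[X in measurable X]setTI.
have mv : measurable_fun setT (v t : T -> R).
  apply: measurable_funM => //; rewrite /v.
  apply: (@measurableT_comp _ _ _ _ _ _ (@Num.norm R R)) => //.
  by case: (block_active _ _ _) => //; exact: measurable_coef.
have := mv measurableT `](eps * M - n.+1%:R^-1), +oo[%classic (measurable_itv _).
by congr measurable; congr (_ `&` _); apply/seteqP; split => f /=; rewrite in_itv/= andbT.
Qed.

Lemma large_le eps eps' rho j (f : Cs_type b s M0) : eps' <= eps ->
  large eps rho j f -> large eps' rho j f.
Proof. by move=> e; apply: le_trans; rewrite lee_fin ler_wpM2r// ltW. Qed.

Lemma measurable_D : measurable D.
Proof.
(* Since [large] weakens as [eps] decreases, [eps = 1/(n+2)], always in ]0, 1[, suffices, and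
   [rho = r + 1] covers all positive [rho]: the union is countable. *)
pose L n r : set T := if s < smax
  then \bigcap_(j in [set j | (j0 <= j)%N])
    large (b := b) (s := s) (M0 := M0) n.+2%:R^-1 r.+1 j
  else large (b := b) (s := s) (M0 := M0) n.+2%:R^-1 r.+1 j0.
have -> : D = ~` \bigcup_n \bigcup_r L n r.
  apply/seteqP; split=> f.
    move=> /DP nf [n _ [r _]]; rewrite /L => lf.
    apply: (nf n.+2%:R^-1 r.+1) => //.
      by rewrite invr_gt0 ltr0n/= invf_lt1 ?ltr1n ?ltr0n.
    by move: lf; case: ifP.
  move=> nf; apply/DP => eps rho /andP[e0 e1] r0 lf; apply: nf.
  have [n] := ltr_add_invr e0; rewrite add0r => ne.
  have ne' : n.+2%:R^-1 <= eps.
    by apply: le_trans (ltW ne); rewrite lef_pV2 ?posrE ?ltr0n// ler_nat.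
  exists n => //; exists rho.-1 => //; rewrite /L prednK//.
  move: lf; case: ifP => _; last exact: large_le.
  by move=> lf j /= jj; apply: large_le ne' _; exact: lf.
apply: measurableC; apply: bigcup_measurable => n _; apply: bigcup_measurable => r _.
rewrite /L; case: ifP => _; last exact: measurable_large.
by apply: bigcap_measurableType => j jj; exact: measurable_large.
Qed.

Variable P : probability T R.
Hypothesis P_prior : wavelet_prior P.

Let interval_bound (t : W) : set (measurableTypeR R) :=
  `](- (M / (2 * coef_weight s t))), (M / (2 * coef_weight s t))[%classic.

Let X (t : W) (f : Cs_type b s M0) := coef (Cs_val f) t.

(** For a wavelet index the prior scale is [M] over [coef_weight], so the event is that a uniform
    variable on [-1, 1] falls in ]-1/2, 1/2[. *)
Lemma prob_coef_half i :
  P (X (first_index b i) @^-1` interval_bound (first_index b i)) = (1 / 2)%:E.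
Proof.
rewrite P_prior.2; last exact: measurable_itv.
rewrite -uniform_prob_half; congr uniform_prob.
have := coef_weight_gt0 s (first_index b i).
rewrite /interval_bound /= powRN; set w := 2 `^ _ => w0.
have -> : M / (2 * w) = M / w * (1 / 2) by field; rewrite gt_eqF.
by apply/seteqP; split=> u /=; rewrite !in_itv/= -!ltr_norml normrM
  (gtr0_norm (divr_gt0 M0 w0)) ltr_pM2l ?divr_gt0.
Qed.

Definition small_coefs m n : set T :=
  [set f | forall i, (m <= i < m + n)%N ->
     scaled_coef (first_index b i) (f : Cs_type b s M0) < 1 / 2 * M].

(** The form to which independence over a finite set of indices applies. *)
Lemma small_coefsE m n : small_coefs m n =
  \bigcap_(t in [set` seq_fset tt (map (first_index b) (iota m n))])
    X t @^-1` interval_bound t.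
Proof.
have itvE t (f : T) : (X t @^-1` interval_bound t) f <->
    scaled_coef t (f : Cs_type b s M0) < 1 / 2 * M.
  have w0 := coef_weight_gt0 s t.
  rewrite /interval_bound /= in_itv/= -ltr_norml /scaled_coef.
  by rewrite invfM mulrA ltr_pdivlMr// mulrC (mulrC (1 / 2)) mul1r.
apply/seteqP; split=> f /= sf t.
  move=> tF; apply/itvE.
  have : t \in map (first_index b) (iota m n) by rewrite -(seq_fsetE tt); exact: tF.
  by case/mapP => i; rewrite mem_iota => mi ->; exact: sf.
move=> mi; apply/itvE/sf.
have : first_index b t \in seq_fset tt (map (first_index b) (iota m n)).
  by rewrite seq_fsetE map_f// mem_iota.
exact.
Qed.

Lemma measurable_small_coefs m n : measurable (small_coefs m n).
Proof.
rewrite small_coefsE; apply: fin_bigcap_measurable; first exact: finite_fset.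
move=> t _; rewrite -[X in measurable X]setTI.
by apply: measurable_coef => //; exact: measurable_itv.
Qed.

Lemma prob_small_coefs m n : P (small_coefs m n) = ((1 / 2) ^+ n)%:E.
Proof.
rewrite small_coefsE P_prior.1; last by move=> t; exact: measurable_itv.
have u : uniq (map (first_index b) (iota m n)).
  by rewrite map_inj_uniq ?iota_uniq//; exact: first_index_inj.
rewrite (perm_big _ (seq_fset_perm tt _)) undup_id// big_map.
under eq_bigr do rewrite prob_coef_half.
by rewrite prodEFin big_const_seq count_predT size_iota -Monoid.iteropE.
Qed.

Lemma prob_D : P D = 0%E.
Proof.
apply/eqP; rewrite eq_le measure_ge0 andbT; apply/lee_addgt0Pr => eps eps0.
rewrite add0e.
have [n ne] : exists n, (1 / 2 ^+ n : R) <= eps.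
  have [n] := ltr_add_invr eps0; rewrite add0r => ne; exists n.
  apply: le_trans (ltW ne); rewrite div1r lef_pV2 ?posrE ?exprn_gt0 ?ltr0n//.
  by rewrite -natrX ler_nat ltn_expl.
apply: (@le_trans _ _ (1 / 2 ^+ n)%:E); last by rewrite lee_fin.
(* With [rho = n + 2] and [j = j0 + m], the levels from [j] up to but excluding [(n + 2) * j] number
   [(n + 1) * j]. *)
pose E m := small_coefs m (n.+1 * (j0 + m)).
have DE : D `<=` \bigcup_m E m.
  move=> f Df; have [||j jj sj] := @D_small_levels _ _ _ _ _ _ f (1 / 2) n.+2 Df => //.
    by apply/andP; split; lra.
  exists (j - j0)%N => // i /= /andP[mi im]; apply: sj.
  by move: im; rewrite subnKC// [(n.+2 * j)%N]mulSn; lia.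
apply: (le_trans (measure_sigma_subadditive P _ _ DE)).
- by move=> m; exact: measurable_small_coefs.
- exact: measurable_D.
(* The bound [1 / 2 ^+ n] is the sum over [m] of [2^{-(m+n+1)}], and
   [m + n + 1 <= (n + 1) * (j0 + m)] because [j0 >= 1]. *)
have /cvg_lim <- // := @cvg_geometric_eseries_half R 1 n.
apply: lee_nneseries => [m _ _|m _]; first exact: measure_ge0.
apply: (@le_trans _ _ ((1 / 2) ^+ (n.+1 * (j0 + m)))%:E).
  by rewrite le_eqVlt; apply/orP; left; apply/eqP; exact: prob_small_coefs.
rewrite lee_fin !div1r exprVn -natrX lef_pV2 ?posrE ?ltr0n ?expn_gt0//.
rewrite ler_nat leq_exp2l// mulSn.
have : (n <= n * (j0 + m))%N by rewrite leq_pmulr// addn_gt0 wj0_gt0.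
by have := wj0_gt0 b; lia.
Qed.

End Measurability.

Theorem proposition2p3 (R : realType) (b : cdv_basis R) (smax s M : R)
    (hsmax : 0 < smax < (wN b)%:R) (hs : 0 < s <= smax) (hM : 0 < M) :
  let D : set (Cs_type b s hM) :=
    @Cs_val R b s M hM @^-1` not_self_similar b smax s M in
  nowhere_dense D /\
  forall P : probability (g_sigma_algebraType (coef_cylinders b s hM)) R,
    wavelet_prior P ->
    measurable (D : set (g_sigma_algebraType (coef_cylinders b s hM))) /\
    P D = 0%E.
Proof.
move=> D; split; first by apply: D_nowhere_dense; case/andP: hs.
by move=> P P_prior; split; [exact: measurable_D | exact: prob_D].
Qed.
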